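(* Let $A$ and $B$ be two pure partial planes of the same order $n$, neither of which is a finite projective plane. Then $A$ and $B$ are isomorphic if and only if their point-line-adjacency graphs are isomorphic (as graphs).
   Context: A pure partial plane of order $n$ and size $s$ is a set $X$ of $n^2+n+1$ points together with a collection of $s$ distinct lines, each line being a subset of $X$ of cardinality $n+1$, such that any two distinct lines intersect in exactly one point. A finite projective plane of order $n$ is one with $n^2+n+1$ lines in which additionally every point is on $n+1$ lines and any two distinct points lie on exactly one line. Two pure partial planes are isomorphic if there are a bijection between their point sets and a bijection between their line sets preserving incidence. The point-line-adjacency graph of a pure partial plane of order $n$ and size $s$ is the simple undirected bipartite graph on $n^2+n+1+s$ vertices, one vertex for each point (including points on no line) and one for each line, in which a line-vertex is adjacent to a point-vertex exactly when the line contains the point. *)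

(* Defs.v *)
From mathcomp Require Import all_boot.

Set Implicit Arguments.
Unset Strict Implicit.
Unset Printing Implicit Defensive.

Record pure_partial_plane (n s : nat) := PurePartialPlane {
  point : finType;
  lines : {set {set point}};
  card_point : #|point| = n ^ 2 + n + 1;
  card_lines : #|lines| = s;
  card_line : forall L, L \in lines -> #|L| = n + 1;
  card_lineI : forall L M, L \in lines -> M \in lines -> L != M ->
    #|L :&: M| = 1
}.

Definition line n s (A : pure_partial_plane n s) : finType :=
  {L : {set point A} | L \in lines A}.

Definition incident n s (A : pure_partial_plane n s) (p : point A) (L : line A)
  : bool := p \in val L.

Definition projective_plane n s (A : pure_partial_plane n s) : Prop :=
  [/\ s = n ^ 2 + n + 1,
      forall p : point A, #|[set L : line A | incident p L]| = n + 1
    & forall p q : point A, p != q ->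
        #|[set L : line A | incident p L && incident q L]| = 1].

Definition plane_isomorphic n s t (A : pure_partial_plane n s)
    (B : pure_partial_plane n t) : Prop :=
  exists (f : point A -> point B) (g : line A -> line B),
    [/\ bijective f, bijective g
      & forall p L, incident (f p) (g L) = incident p L].

Record sgraph := SGraph {
  vertex : finType;
  adj : rel vertex;
  adj_sym : symmetric adj;
  adj_irrefl : irreflexive adj
}.

Definition graph_isomorphic (G H : sgraph) : Prop :=
  exists2 h : vertex G -> vertex H,
    bijective h & forall u v, adj (h u) (h v) = adj u v.

Section PointLineGraph.
Variables (n s : nat) (A : pure_partial_plane n s).

Definition point_line_adj : rel (point A + line A) := fun u v =>
  match u, v with
  | inl p, inr L | inr L, inl p => incident p L
  | _, _ => false
  end.

Lemma point_line_adj_sym : symmetric point_line_adj.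
Proof. by case=> [p|L] [q|M]. Qed.

Lemma point_line_adj_irrefl : irreflexive point_line_adj.
Proof. by case. Qed.

Definition point_line_graph : sgraph :=
  SGraph point_line_adj_sym point_line_adj_irrefl.

End PointLineGraph.

(* Main.v *)
Require Import Defs.
From mathcomp Require Import all_boot.

(** Any two lines meet, so all lines lie in one component of the graph, and a
    graph isomorphism sends either every line to a line or every line to a
    point. In the first case it restricts to an isomorphism of planes. In the
    second case the dual of each axiom on lines holds for the points of [A]
    that are on some line; counting the points on the lines through one of
    them then shows that no point is off all lines, so [A] is projective. *)

Set Implicit Arguments.
Unset Strict Implicit.
Unset Printing Implicit Defensive.

Section Plane.
Variables (n s : nat) (A : pure_partial_plane n s).

Lemma card_line_type : #|line A| = s.
Proof. by rewrite card_sig -[RHS](card_lines A); apply: eq_card. Qed.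

Lemma card_incident (L : line A) : #|[set p | incident p L]| = n + 1.
Proof.
by rewrite -(card_line (valP L)); apply: eq_card => p; rewrite inE.
Qed.

Lemma line_has_point (L : line A) : exists p, incident p L.
Proof.
have: 0 < #|[set p | incident p L]| by rewrite card_incident addn1.
by case/card_gt0P=> p; rewrite inE; exists p.
Qed.

Lemma card_incident2 (L M : line A) : L != M ->
  #|[set p | incident p L && incident p M]| = 1.
Proof.
move=> neqLM; rewrite -(card_lineI (valP L) (valP M) neqLM).
by apply: eq_card => p; rewrite !inE.
Qed.

Lemma lines_meet (L M : line A) : exists2 p, incident p L & incident p M.
Proof.
have [<-|neqLM] := eqVneq L M.
  by have [p pL] := line_has_point L; exists p.
have: 0 < #|[set p | incident p L && incident p M]| by rewrite card_incident2.
by case/card_gt0P=> p; rewrite inE => /andP[pL pM]; exists p.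
Qed.

(** A point on no line is an isolated vertex, about which adjacency says nothing, so the dual axioms
    can be transferred only for covered points. *)
Definition covered (p : point A) := [exists L : line A, incident p L].

(** [L0] supplies a covered point to count from; with no lines at all both hypotheses would hold
    vacuously. *)
Lemma dual_axioms_projective (L0 : line A) :
    (forall p, covered p -> #|[set L : line A | incident p L]| = n + 1) ->
    (forall p q, covered p -> covered q -> p != q ->
       #|[set L : line A | incident p L && incident q L]| = 1) ->
  projective_plane A.
Proof.
move=> deg join; have [p0 p0L0] := line_has_point L0.
have cov0 : covered p0 by apply/existsP; exists L0.
pose joins q := #|[set L : line A | incident p0 L && incident q L]|.
(* [joins q] is 1 for covered [q] and 0 otherwise; keeping the equality case lets an equality of
   sums be read back at each [q]. *)
have joins_le1 q : q != p0 -> joins q <= 1 ?= iff covered q.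
  move=> neq; have [covq|ncovq] := boolP (covered q).
    by rewrite /joins join // 1?eq_sym //; apply/leqif_refl.
  rewrite /joins (_ : [set _ | _] = set0) ?cards0 //.
  apply/setP=> L; rewrite !inE; apply: contraNF ncovq => /andP[_ qL].
  by apply/existsP; exists L.
(* Double counting: each of the [n + 1] lines through [p0] has [n] further points. *)
have sum_joins : \sum_(q | q != p0) joins q = (n + 1) * n.
  under eq_bigr do rewrite /joins -sum1dep_card big_mkcondr.
  rewrite exchange_big /= -(deg _ cov0) -sum1dep_card big_distrl /=.
  apply: eq_bigr => L p0L; rewrite mul1n -big_mkcondr /= sum1dep_card.
  apply: (@addnI 1); rewrite [RHS]addnC -(card_incident L).
  rewrite [RHS](cardsD1 p0) inE p0L; congr (_ + _).
  by apply: eq_card => q; rewrite !inE.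
have card_neq : \sum_(q | q != p0) 1 = (n + 1) * n.
  rewrite sum1_card cardC1 (card_point A) addn1 /=.
  by rewrite -mulnn mulnDl mul1n.
(* The sum attains its termwise bound, the number of points other than [p0], so every term equals
   1. *)
have all_cov p : covered p.
  have [-> //|neq] := eqVneq p p0.
  have [_] := leqif_sum joins_le1; rewrite sum_joins card_neq eqxx.
  by move/esym/forall_inP; apply.
split=> [|p|p q]; [|exact: deg|exact: join].
(* For the number of lines, count incident pairs by lines and by points: both have degree [n + 1], a
   positive factor that cancels. *)
have n1_gt0 : 0 < n + 1 by rewrite addn1.
apply/eqP; rewrite -(eqn_pmul2r n1_gt0) -[in X in X == _]card_line_type.
apply/eqP; rewrite -(card_point A) -!sum_nat_const.
transitivity (\sum_(L : line A) \sum_(p | incident p L) 1).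
  by apply: eq_bigr => L _; rewrite sum1dep_card card_incident.
rewrite (exchange_big_dep xpredT) //=; apply: eq_bigr => p _.
by rewrite sum1dep_card deg.
Qed.

End Plane.

Lemma plane_isomorphic_graph n s t (A : pure_partial_plane n s)
    (B : pure_partial_plane n t) :
  plane_isomorphic A B ->
  graph_isomorphic (point_line_graph A) (point_line_graph B).
Proof.
case=> f [g [[f' fK f'K] [g' gK g'K] fgP]].
pose h (u : point A + line A) : point B + line B :=
  match u with inl p => inl (f p) | inr L => inr (g L) end.
pose h' (u : point B + line B) : point A + line A :=
  match u with inl p => inl (f' p) | inr L => inr (g' L) end.
exists h; last by case=> [p|L] [q|M] /=.
by exists h'; [case=> x /=; rewrite ?fK ?gK | case=> x /=; rewrite ?f'K ?g'K].
Qed.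

Section GraphIso.
Variables (n s t : nat) (A : pure_partial_plane n s).
Variables (B : pure_partial_plane n t).
Variables (h : point A + line A -> point B + line B).
Variables (h' : point B + line B -> point A + line A).
Hypotheses (hK : cancel h h') (h'K : cancel h' h).
Hypothesis h_adj :
  forall u v, point_line_adj (h u) (h v) = point_line_adj u v.

(** If a point [p] went to a line [M], the preimage of a point of [M] would be adjacent to [p],
    hence a line sent to a point. So [h] and [h'] both respect the two sides and split into maps on
    points and on lines. *)
Lemma line_preserving_plane_isomorphic :
  (forall L, exists M, h (inr L) = inr M) -> plane_isomorphic A B.
Proof.
move=> h_line.
have h_point p : exists q, h (inl p) = inl q.
  case hp: (h (inl p)) => [q|M]; first by exists q.
  have [q qM] := line_has_point M.
  have := h_adj (inl p) (h' (inl q)); rewrite h'K hp /= qM.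
  case h'q: (h' (inl q)) => [//|L] _.
  by have [N] := h_line L; rewrite -h'q h'K.
have h'_point q : exists p, h' (inl q) = inl p.
  case h'q: (h' (inl q)) => [p|L]; first by exists p.
  by have [N] := h_line L; rewrite -h'q h'K.
have h'_line M : exists L, h' (inr M) = inr L.
  case h'M: (h' (inr M)) => [p|L]; last by exists L.
  by have [q] := h_point p; rewrite -h'M h'K.
have [[f fP] [g gP]] := (fin_all_exists h_point, fin_all_exists h_line).
have [[f' f'P] [g' g'P]] := (fin_all_exists h'_point, fin_all_exists h'_line).
exists f, g; split=> [||p L]; last first.
- by have := h_adj (inl p) (inr L); rewrite fP gP.
- exists g' => L.
    by have := hK (inr L); rewrite gP g'P => -[].
  by have := h'K (inr L); rewrite g'P gP => -[].
exists f' => p.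
  by have := hK (inl p); rewrite fP f'P => -[].
by have := h'K (inl p); rewrite f'P fP => -[].
Qed.

(** Covered points of [A] become lines of [B], so the line size and the intersection axiom of [B]
    pull back to the dual axioms for [A]. *)
Lemma line_reversing_projective (L0 : line A) :
  (forall L, exists q, h (inr L) = inl q) -> projective_plane A.
Proof.
move=> h_line; have [g gP] := fin_all_exists h_line.
have g_inj : injective g.
  by move=> L M eqg; have := hK (inr L); rewrite gP eqg -gP hK => -[].
have h_cov p : covered p -> exists M, h (inl p) = inr M.
  case/existsP=> L pL; have := h_adj (inl p) (inr L); rewrite gP /= pL.
  by case: (h (inl p)) => [//|M] _; exists M.
have g_incident p M L : h (inl p) = inr M -> incident (g L) M = incident p L.
  by move=> hp; have := h_adj (inl p) (inr L); rewrite hp gP.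
(* All points of the line [M] come from lines of [A]: their preimages are adjacent to the point [p].
   Hence [g] maps the lines through [p] onto the points of [M]. *)
have g_onto p M q : h (inl p) = inr M -> incident q M -> exists L, q = g L.
  move=> hp qM; have := h_adj (inl p) (h' (inl q)); rewrite h'K hp /= qM.
  case h'q: (h' (inl q)) => [//|L] _; exists L.
  by have := gP L; rewrite -h'q h'K => -[].
apply: (dual_axioms_projective L0) => [p /h_cov[M hp]|p q].
  rewrite -(card_incident M) -(card_imset _ g_inj).
  apply: eq_card => q; rewrite inE; apply/imsetP/idP => [[L]|qM].
    by rewrite inE => pL ->; rewrite (g_incident p).
  have [L eq_q] := g_onto _ _ _ hp qM; exists L => //.
  by rewrite inE -(g_incident _ _ _ hp) -eq_q.
move=> /h_cov[M hp] /h_cov[N hq] neq_pq.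
have neqMN : M != N.
  apply: contraNneq neq_pq => eqMN.
  by have := hK (inl p); rewrite hp eqMN -hq hK => -[->].
rewrite -(card_incident2 neqMN) -(card_imset _ g_inj).
apply: eq_card => r; rewrite inE; apply/imsetP/idP => [[L]|/andP[rM rN]].
  by rewrite inE => /andP[pL qL] ->; rewrite (g_incident p) // (g_incident q) // pL.
have [L eq_r] := g_onto _ _ _ hp rM; exists L => //.
by rewrite inE -(g_incident _ _ _ hp) -(g_incident _ _ _ hq) -eq_r rM.
Qed.

(** Two lines share a point [p], and both their images are adjacent to the image of [p], so they lie
    on the same side of [B]. A plane without lines falls under the first alternative. *)
Lemma line_preserving_or_reversing :
  (forall L, exists M, h (inr L) = inr M) \/
  (exists L0 : line A, forall L, exists q, h (inr L) = inl q).
Proof.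
have side L M N : h (inr L) = inr N -> exists N', h (inr M) = inr N'.
  move=> hL; have [p pL pM] := lines_meet L M.
  have := h_adj (inl p) (inr L); rewrite hL /= pL.
  have := h_adj (inl p) (inr M); rewrite /= pM.
  case: (h (inl p)) => [q|//]; case: (h (inr M)) => [//|N'] _ _.
  by exists N'.
case: (pickP (line A)) => [L0 _|noL]; last by left=> L; have := noL L.
case hL0: (h (inr L0)) => [q0|N0]; last by left=> L; apply: side hL0.
right; exists L0 => L; case hL: (h (inr L)) => [q|N]; first by exists q.
by have [N'] := side _ L0 _ hL; rewrite hL0.
Qed.

End GraphIso.

Theorem theorem4 (n s t : nat) (A : pure_partial_plane n s)
    (B : pure_partial_plane n t) :
  ~ projective_plane A -> ~ projective_plane B ->
  plane_isomorphic A B <->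
  graph_isomorphic (point_line_graph A) (point_line_graph B).
Proof.
move=> nprojA _; split=> [|[h [h' hK h'K] h_adj]].
  exact: plane_isomorphic_graph.
have [pres|[L0 rev]] := line_preserving_or_reversing h_adj.
  exact: line_preserving_plane_isomorphic hK h'K h_adj pres.
by case: nprojA; apply: line_reversing_projective hK h'K h_adj L0 rev.
Qed.
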